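(* Let $G$ be an arbitrary group and let $H=\bigoplus_{g\in G}H_g$ be a faithfully $G$-graded quasi-Hopf algebra over a field $\Bbbk$. The assignments \[ I\longmapsto (N_I,\ I\cap H_{N_I}) \qquad\text{and}\qquad (N,K)\longmapsto K^{G/N}:=\sum_{\bar g\in G/N}H_{\bar g}K \] are well defined and mutually inverse, i.e. they define a bijective correspondence between the set of quasi-Hopf ideals $I$ of $H$ and the set of admissible pairs $(N,K)$ for $H$.
   Context: Conventions. $\Bbbk$ is a field; vector spaces, algebras and tensor products are over $\Bbbk$; algebras are unital and algebra (anti-)morphisms preserve units. For subspaces $U,V$ of an algebra, $UV$ is the linear span of the products $uv$. Summation is suppressed: $\Delta(x)=x'\otimes x''$, $\Phi=\Phi^{(1)}\otimes\Phi^{(2)}\otimes\Phi^{(3)}$, $\Phi^{-1}=\Phi^{(-1)}\otimes\Phi^{(-2)}\otimes\Phi^{(-3)}$. Quasi-Hopf algebras. A quasi-Hopf algebra is an algebra $H$ with algebra morphisms $\Delta\colon H\to H\otimes H$, $\varepsilon\colon H\to\Bbbk$, an invertible $\Phi\in H^{\otimes 3}$, an algebra anti-morphism $S\colon H\to H$ (not assumed bijective) and elements $\alpha,\beta\in H$ such that for all $x\in H$: $(1\otimes\Phi)(\mathrm{id}\otimes\Delta\otimes\mathrm{id})(\Phi)(\Phi\otimes1)=(\mathrm{id}\otimes\mathrm{id}\otimes\Delta)(\Phi)(\Delta\otimes\mathrm{id}\otimes\mathrm{id})(\Phi)$; $\Phi(\Delta\otimes\mathrm{id})(\Delta(x))=(\mathrm{id}\otimes\Delta)(\Delta(x))\Phi$;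 $(\mathrm{id}\otimes\varepsilon\otimes\mathrm{id})(\Phi)=1\otimes1$; $(\mathrm{id}\otimes\varepsilon)\Delta(x)=x=(\varepsilon\otimes\mathrm{id})\Delta(x)$; $S(x')\alpha x''=\varepsilon(x)\alpha$; $x'\beta S(x'')=\varepsilon(x)\beta$; $\Phi^{(1)}\beta S(\Phi^{(2)})\alpha\Phi^{(3)}=1=S(\Phi^{(-1)})\alpha\Phi^{(-2)}\beta S(\Phi^{(-3)})$. Throughout, $(\alpha,\beta)$ is normalized by $\varepsilon(\alpha)=\varepsilon(\beta)=1$. A quasi-Hopf ideal of $H$ is a two-sided ideal $I$ with $\Delta(I)\subseteq I\otimes H+H\otimes I$, $\varepsilon(I)=0$, $S(I)\subseteq I$. Gradings. For a group $G$ with identity $e$, a $G$-graded quasi-Hopf algebra is a quasi-Hopf algebra with a vector space decomposition $H=\bigoplus_{g\in G}H_g$ such that $H_gH_h\subseteq H_{gh}$, $\Delta(H_g)\subseteq H_g\otimes H_g$, $S(H_g)\subseteq H_{g^{-1}}$, $\Phi\in H_e^{\otimes3}$, $\alpha,\beta\in H_e$. It is faithfully graded if $H_g\neq0$ for all $g\in G$. The group algebra $\Bbbk[G]$ has basis $\{\zeta_g\}_{g\in G}$ with $\zeta_g\zeta_h=\zeta_{gh}$ and is a Hopf algebra with every $\zeta_g$ group-like. The grading map of a faithfully graded $H$ is the linear map $\pi\colon H\to\Bbbk[G]$, $\pi(x_g)=\varepsilon(x_g)\zeta_g$ for $x_g\in H_g$. For a subgroup $N$, $\mathfrak{a}_N$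 denotes the augmentation ideal of $\Bbbk[N]\subseteq\Bbbk[G]$ (the span of $\zeta_n-\zeta_e$, $n\in N$). Subgroups. For $N\unlhd G$ and $\bar g=gN\in G/N$ put $H_{\bar g}=\bigoplus_{n\in N}H_{gn}$ and $H_N=H_{\bar e}=\bigoplus_{n\in N}H_n$; $H_N$ is a quasi-Hopf algebra with the restricted structure. For a quasi-Hopf ideal $I$ of $H$, $N_I$ is the unique normal subgroup of $G$ with $\pi(I)=\mathfrak{a}_{N_I}\cdot\Bbbk[G]$; explicitly $N_I=\{g\in G\mid\zeta_g-\zeta_e\in\pi(I)\}$. Admissible pairs. An admissible pair for $H$ is a pair $(N,K)$ such that (i) $N\unlhd G$; (ii) $K$ is a quasi-Hopf ideal of $H_N$; (iii) $K$ is $G/N$-invariant: $H_{\bar g}K=KH_{\bar g}$ for every $\bar g\in G/N$; (iv) $\mathfrak{a}_N\subseteq\pi(K)$. *)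

(* Defs.v *)
From HB Require Import structures.
From mathcomp Require Import all_boot all_algebra generic_quotient finmap.
From mathcomp Require Import boolp classical_sets functions.
From mathcomp Require Import multinomials.monalg.

Set Implicit Arguments.
Unset Strict Implicit.
Unset Printing Implicit Defensive.

Import GRing.Theory.
Local Open Scope ring_scope.
Local Open Scope quotient_scope.
Local Open Scope classical_set_scope.

(* U (x) V consists of finite formal sums of pairs, two sums being identified
   when every bilinear map out of U x V takes the same value on them; see
   tensor_universal for the universal property. *)
Section Tensor.
Variables (K : fieldType) (U V : lmodType K).

Definition bilin (W : lmodType K) (f : U -> V -> W) : Prop :=
  (forall v, linear (f^~ v)) /\ (forall u, linear (f u)).

Definition fsum (W : lmodType K) (f : U -> V -> W) (s : seq (U * V)) : W :=
  \sum_(p <- s) f p.1 p.2.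

Definition tequiv (s t : seq (U * V)) : bool :=
  `[< forall (W : lmodType K) (f : U -> V -> W),
        bilin f -> fsum f s = fsum f t >].

Lemma tequiv_refl : reflexive tequiv.
Proof. by move=> s; apply/asboolP. Qed.

Lemma tequiv_sym : symmetric tequiv.
Proof. by move=> s t; apply/asboolP/asboolP => h W f bf; rewrite h. Qed.

Lemma tequiv_trans : transitive tequiv.
Proof.
by move=> t s r /asboolP h1 /asboolP h2; apply/asboolP => W f bf; rewrite h1 ?h2.
Qed.

Canonical tequiv_equiv := EquivRel tequiv tequiv_refl tequiv_sym tequiv_trans.

Definition tensor := {eq_quot tequiv}.
HB.instance Definition _ := Choice.on tensor.

Definition formal (s : seq (U * V)) : tensor := \pi s.
Definition tens (u : U) (v : V) : tensor := formal [:: (u, v)].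

(* Sweedler summation: for bilinear f, the sum of f t' t'' where
   t = t' (x) t''; for other f it depends on the representative. *)
Definition tsum (W : lmodType K) (f : U -> V -> W) (t : tensor) : W :=
  fsum f (repr t).

Lemma tsum_formal (W : lmodType K) (f : U -> V -> W) s :
  bilin f -> tsum f (formal s) = fsum f s.
Proof.
rewrite /tsum; have /eqmodP /asboolP h : repr (formal s) = s %[mod tensor].
  by rewrite reprK.
exact: h.
Qed.

Lemma tsum_ext (x y : tensor) :
  (forall (W : lmodType K) (f : U -> V -> W), bilin f -> tsum f x = tsum f y) ->
  x = y.
Proof.
move=> h; rewrite -[x]reprK -[y]reprK; apply/eqmodP/asboolP => W f.
exact: h.
Qed.

Definition tens_add (x y : tensor) : tensor := formal (repr x ++ repr y).
Definition tens_scale (a : K) (x : tensor) : tensor :=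
  formal [seq (a *: p.1, p.2) | p <- repr x].
Definition tens_opp (x : tensor) : tensor := tens_scale (-1) x.
Definition tens_zero : tensor := formal [::].

Section Eval.
Variables (W : lmodType K) (f : U -> V -> W) (bf : bilin f).

Lemma bilinZl a u v : f (a *: u) v = a *: f u v.
Proof.
have f0 : f 0 v = 0 by have := bf.1 v (-1) 0 0; rewrite scaler0 addr0 scaleN1r addNr.
by have := bf.1 v a u 0; rewrite f0 !addr0.
Qed.

Lemma tsum_add x y : tsum f (tens_add x y) = tsum f x + tsum f y.
Proof. by rewrite tsum_formal // /fsum big_cat. Qed.

Lemma tsum_zero : tsum f tens_zero = 0.
Proof. by rewrite tsum_formal // /fsum big_nil. Qed.

Lemma tsum_scale a x : tsum f (tens_scale a x) = a *: tsum f x.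
Proof.
rewrite tsum_formal // /fsum big_map scaler_sumr; apply: eq_bigr => p _ /=.
exact: bilinZl.
Qed.

Lemma tsum_opp x : tsum f (tens_opp x) = - tsum f x.
Proof. by rewrite tsum_scale scaleN1r. Qed.

Lemma tsum_tens u v : tsum f (tens u v) = f u v.
Proof. by rewrite tsum_formal // /fsum big_seq1. Qed.

End Eval.

Fact tens_addA : associative tens_add.
Proof. by move=> x y z; apply: tsum_ext => W f bf; rewrite !tsum_add // addrA. Qed.
Fact tens_addC : commutative tens_add.
Proof. by move=> x y; apply: tsum_ext => W f bf; rewrite !tsum_add // addrC. Qed.
Fact tens_add0 : left_id tens_zero tens_add.
Proof.
by move=> x; apply: tsum_ext => W f bf; rewrite tsum_add // tsum_zero // add0r.
Qed.
Fact tens_addN : left_inverse tens_zero tens_opp tens_add.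
Proof.
move=> x; apply: tsum_ext => W f bf.
by rewrite tsum_add // tsum_opp // tsum_zero // addNr.
Qed.

HB.instance Definition _ :=
  GRing.isZmodule.Build tensor tens_addA tens_addC tens_add0 tens_addN.

Fact tens_scaleA a b x : tens_scale a (tens_scale b x) = tens_scale (a * b) x.
Proof. by apply: tsum_ext => W f bf; rewrite !tsum_scale // scalerA. Qed.
Fact tens_scale1 : left_id 1 tens_scale.
Proof. by move=> x; apply: tsum_ext => W f bf; rewrite tsum_scale // scale1r. Qed.
Fact tens_scaleDr : right_distributive tens_scale +%R.
Proof.
move=> a x y; apply: tsum_ext => W f bf.
by rewrite tsum_scale // !tsum_add // !tsum_scale // scalerDr.
Qed.
Fact tens_scaleDl x : {morph tens_scale^~ x : a b / a + b}.
Proof.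
move=> a b; apply: tsum_ext => W f bf.
by rewrite tsum_add // !tsum_scale // scalerDl.
Qed.

HB.instance Definition _ := GRing.Zmodule_isLmodule.Build K tensor
  tens_scaleA tens_scale1 tens_scaleDr tens_scaleDl.

Lemma tsum_linear (W : lmodType K) (f : U -> V -> W) :
  bilin f -> linear (tsum f).
Proof. by move=> bf a x y; rewrite [LHS]tsum_add // tsum_scale. Qed.

Lemma tsumD (W : lmodType K) (f : U -> V -> W) (x y : tensor) :
  bilin f -> tsum f (x + y) = tsum f x + tsum f y.
Proof. by move=> bf; rewrite [LHS]tsum_add. Qed.

Lemma tsum0 (W : lmodType K) (f : U -> V -> W) : bilin f -> tsum f 0 = 0.
Proof. by move=> bf; rewrite [LHS]tsum_zero. Qed.

Lemma tens_bilin : bilin tens.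
Proof.
by split=> [v a u u' | u a v v']; apply: tsum_ext => W f bf;
  rewrite tsum_linear // !tsum_tens //; apply bf.
Qed.

Lemma formalE s : formal s = \sum_(p <- s) tens p.1 p.2.
Proof.
apply: tsum_ext => W f bf; rewrite tsum_formal // /fsum.
elim: s => [|p s IH]; first by rewrite !big_nil tsum0.
by rewrite !big_cons tsumD // tsum_tens // IH.
Qed.

Lemma tens_ind (P : tensor -> Prop) :
  P 0 -> (forall u v x, P x -> P (tens u v + x)) -> forall x, P x.
Proof.
move=> P0 PD x; rewrite -[x]reprK -/(formal _) formalE.
by elim: (repr x) => [|p s IH]; rewrite ?big_nil // big_cons; apply: PD.
Qed.

Theorem tensor_universal (W : lmodType K) (f : U -> V -> W) : bilin f ->
  exists h : {linear tensor -> W}, (forall u v, h (tens u v) = f u v) /\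
    forall g : {linear tensor -> W},
      (forall u v, g (tens u v) = f u v) -> g =1 h.
Proof.
move=> bf; pose hm := GRing.isLinear.Build K tensor W *:%R (tsum f) (tsum_linear bf).
pose h : {linear tensor -> W} := HB.pack (tsum f) hm.
exists h; split=> [u v | g gE x]; first exact: tsum_tens.
elim/tens_ind: x => [|u v x IH]; first by rewrite !linear0.
by rewrite !linearD IH gE /= tsum_tens.
Qed.

End Tensor.

Notation "U ⊗ V" := (tensor U%type V%type) (at level 40, left associativity) : type_scope.
Notation "u ⊗ v" := (tens u v) (at level 40, left associativity) : ring_scope.

(* Needs a maximal subspace avoiding v, hence Zorn's lemma; used only to see
   that 1 (x) 1 is nonzero in a tensor product of nonzero algebras. *)
Lemma linear_form_neq0 (K : fieldType) (V : lmodType K) (v : V) :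
  v != 0 -> exists p : {linear V -> K^o}, p v != 0.
Proof.
move=> v0.
pose P (W : set V) := (forall a x y, W x -> W y -> W (a *: x + y)) /\ ~ W v.
have [|W [[Wlin Wv] Wmax]] := @Zorn_bigcup V P.
  move=> F FP Ftot; split=> [a x y [A FA Ax] [B FB By] | [A /FP [_ +]]//].
  have [AB|BA] := Ftot _ _ FA FB.
    by exists B => //; apply: (FP _ FB).1 => //; apply: AB.
  by exists A => //; apply: (FP _ FA).1 => //; apply: BA.
have W0 : W 0.
  apply: contrapT => nW0; apply: (Wmax [set 0]); last first.
    split=> [a x y -> ->|/= /eqP]; first by rewrite /= scaler0 addr0.
    by rewrite (negbTE v0).
  split=> [x Wx|/(_ 0 erefl)//]; case: nW0.
  by have := Wlin (-1) x x Wx Wx; rewrite scaleN1r addNr.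
have WZ a x : W x -> W (a *: x) by move=> Wx; rewrite -[_ *: _]addr0; apply: Wlin.
have WD x y : W x -> W y -> W (x + y) by rewrite -{2}[x]scale1r; apply: Wlin.
have ex x : exists c : K, W (x - c *: v).
  have [Wx|nWx] := pselect (W x); first by exists 0; rewrite scale0r subr0.
  pose W' := [set y | exists a, W (y - a *: x)].
  have : W' v.
    apply: contrapT => nW'v; apply: (Wmax W').
      split=> [y Wy|]; first by exists 0; rewrite scale0r subr0.
      by move=> h; apply: nWx; apply: h; exists 1; rewrite scale1r subrr.
    split=> // a y z [b Wb] [c Wc]; exists (a * b + c).
    have -> : a *: y + z - (a * b + c) *: x = a *: (y - b *: x) + (z - c *: x).
      by rewrite scalerBr scalerA scalerDl opprD addrACA.
    exact: Wlin.
  case=> a Wa; have a0 : a != 0.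
    by apply/eqP => a0; apply: Wv; move: Wa; rewrite a0 scale0r subr0.
  exists a^-1; have := WZ (- a^-1) _ Wa.
  by rewrite scalerBr scalerA mulNr mulVf // scaleN1r opprK scaleNr addrC.
have uniq x c d : W (x - c *: v) -> W (x - d *: v) -> c = d.
  move=> Wc Wd; apply: contrapT => /eqP cd; apply: Wv.
  have := WZ (d - c)^-1 _ (Wlin (-1) _ _ Wd Wc).
  rewrite scaleN1r opprB addrA addrNK -scalerBl scalerA mulVf ?scale1r //.
  by rewrite subr_eq0 eq_sym.
pose p (x : V) : K^o := projT1 (cid (ex x)).
have pP x : W (x - (p x : K) *: v) by rewrite /p; case: cid.
have plin : linear p.
  move=> a x y; apply: (uniq (a *: x + y)); first exact: pP.
  have -> : a *: x + y - (a *: p x + p y : K) *: v =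
            a *: (x - (p x : K) *: v) + (y - (p y : K) *: v).
    by rewrite scalerBr scalerA scalerDl opprD addrACA.
  exact: Wlin.
pose pm := GRing.isLinear.Build K V K^o *:%R p plin.
pose pl : {linear V -> K^o} := HB.pack p pm.
exists pl => /=; suff -> : p v = 1 by rewrite oner_neq0.
by apply: (uniq v); [apply: pP | rewrite scale1r subrr].
Qed.

Section TripleTensor.
Variables (K : fieldType) (U V W X : lmodType K).

Definition tsum3 (f : U -> V -> W -> X) (t : U ⊗ V ⊗ W) : X :=
  tsum (fun (u : U ⊗ V) (c : W) => tsum (fun a b => f a b c) u) t.

Lemma tsum3_tens (f : U -> V -> W -> X) a b c :
  (forall w, bilin (fun u v => f u v w)) -> (forall u v, linear (f u v)) ->
  tsum3 f (a ⊗ b ⊗ c) = f a b c.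
Proof.
move=> f12 f3; rewrite /tsum3 tsum_tens ?tsum_tens //.
split=> [w | u k w w']; first exact: tsum_linear.
rewrite /tsum /fsum scaler_sumr -big_split.
by apply: eq_bigr => p _; apply: f3.
Qed.

End TripleTensor.

Section TensorAlgebra.
Variables (K : fieldType) (A B : algType K).

Definition mul_tens (y : A ⊗ B) (a : A) (b : B) : A ⊗ B :=
  tsum (fun c d => (a * c) ⊗ (b * d)) y.

Definition tens_mul (x y : A ⊗ B) : A ⊗ B := tsum (mul_tens y) x.
Definition tens_one : A ⊗ B := 1 ⊗ 1.

Lemma mul_tens_bilin_r (a : A) (b : B) :
  bilin (fun (c : A) (d : B) => (a * c) ⊗ (b * d)).
Proof.
have [tl tr] := @tens_bilin K A B.
by split=> [d k c c' | c k d d']; rewrite mulrDr -scalerAr ?tl ?tr.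
Qed.

Lemma mul_tens_bilin (y : A ⊗ B) : bilin (mul_tens y).
Proof.
have [tl tr] := @tens_bilin K A B.
split=> [b k a a' | a k b b']; rewrite /mul_tens /tsum /fsum scaler_sumr;
  rewrite -big_split; apply: eq_bigr => -[c d] _ /=;
  by rewrite mulrDl -scalerAl ?tl ?tr.
Qed.

Lemma tens_mul_tens a b c d : tens_mul (a ⊗ b) (c ⊗ d) = (a * c) ⊗ (b * d).
Proof.
rewrite /tens_mul tsum_tens; last exact: mul_tens_bilin.
by rewrite /mul_tens tsum_tens //; apply: mul_tens_bilin_r.
Qed.

Fact tens_mulDl : left_distributive tens_mul +%R.
Proof. by move=> x y z; apply: tsumD; apply: mul_tens_bilin. Qed.

Fact tens_mul0l y : tens_mul 0 y = 0.
Proof. by apply: tsum0; apply: mul_tens_bilin. Qed.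

Fact tens_mulDr : right_distributive tens_mul +%R.
Proof.
move=> x y z; rewrite /tens_mul /tsum /fsum -big_split; apply: eq_bigr => p _.
by apply: tsumD; apply: mul_tens_bilin_r.
Qed.

Fact tens_mul0r x : tens_mul x 0 = 0.
Proof. by apply: (addrI (tens_mul x 0)); rewrite -tens_mulDr !addr0. Qed.

Fact tens_mulA : associative tens_mul.
Proof.
move=> x y z; elim/tens_ind: x => [|a b x IH]; first by rewrite !tens_mul0l.
rewrite !tens_mulDl IH; congr (_ + _).
clear IH; elim/tens_ind: y => [|c d y IH]; first by rewrite !(tens_mul0l, tens_mul0r).
rewrite !(tens_mulDl, tens_mulDr) IH; congr (_ + _).
clear IH; elim/tens_ind: z => [|e f z IH]; first by rewrite !tens_mul0r.
by rewrite !tens_mulDr IH !tens_mul_tens !mulrA.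
Qed.

Fact tens_mul1l : left_id tens_one tens_mul.
Proof.
move=> x; elim/tens_ind: x => [|a b x IH]; first by rewrite tens_mul0r.
by rewrite tens_mulDr IH tens_mul_tens !mul1r.
Qed.

Fact tens_mul1r : right_id tens_one tens_mul.
Proof.
move=> x; elim/tens_ind: x => [|a b x IH]; first by rewrite tens_mul0l.
by rewrite tens_mulDl IH tens_mul_tens !mulr1.
Qed.

Fact tens_one_neq0 : tens_one != 0.
Proof.
have [p p1] := linear_form_neq0 (oner_neq0 A).
have [q q1] := linear_form_neq0 (oner_neq0 B).
have bf : bilin (fun (a : A) (b : B) => p a * q b : K^o).
  split=> [b k a a' | a k b b'] /=.
    by rewrite linearP mulrDl -scalerAl.
  by rewrite linearP mulrDr -scalerAr.
apply/eqP => e; have := tsum_tens bf 1 1.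
rewrite -/tens_one e tsum0 // => /esym/eqP.
by rewrite mulf_eq0 (negbTE p1) (negbTE q1).
Qed.

HB.instance Definition _ := GRing.Zmodule_isNzRing.Build (tensor A B)
  tens_mulA tens_mul1l tens_mul1r tens_mulDl tens_mulDr tens_one_neq0.

Fact tens_scaleAl (k : K) (x y : tensor A B) : k *: (x * y) = (k *: x) * y.
Proof. by apply/esym; apply: (tsum_scale (mul_tens_bilin y)). Qed.
HB.instance Definition _ :=
  GRing.Lmodule_isLalgebra.Build K (tensor A B) tens_scaleAl.

Fact tens_scaleAr (k : K) (x y : tensor A B) : k *: (x * y) = x * (k *: y).
Proof.
rewrite [x * _]/(tens_mul x _) [x * _]/(tens_mul x _) /tens_mul /tsum /fsum scaler_sumr.
by apply: eq_bigr => p _; apply/esym; apply: (tsum_scale (mul_tens_bilin_r _ _)).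
Qed.
HB.instance Definition _ :=
  GRing.Lalgebra_isAlgebra.Build K (tensor A B) tens_scaleAr.

Lemma tensM (a c : A) (b d : B) : (a ⊗ b) * (c ⊗ d) = (a * c) ⊗ (b * d).
Proof. exact: tens_mul_tens. Qed.

Lemma tens1 : 1 = 1 ⊗ 1 :> tensor A B.
Proof. by []. Qed.

End TensorAlgebra.

Section Subspaces.
Variable K : fieldType.

Definition subspace (V : lmodType K) (A : set V) : Prop :=
  submod_closed (mem A).

Definition lspan (V : lmodType K) (A : set V) : set V := smallest (@subspace V) A.

Definition mul_set (A : algType K) (U V : set A) : set A :=
  lspan [set x * y | x in U & y in V].

(* The image of U (x) V in A (x) B; K being a field, it is a copy of U (x) V. *)
Definition tens_set (A B : lmodType K) (U : set A) (V : set B) : set (A ⊗ B) :=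
  lspan [set x ⊗ y | x in U & y in V].

Definition add_set (V : lmodType K) (A B : set V) : set V :=
  [set x + y | x in A & y in B].

End Subspaces.

Record quasiHopf (K : fieldType) (H : algType K) := QuasiHopf {
  Delta : {lrmorphism H -> H ⊗ H};
  eps : {lrmorphism H -> K | *%R};
  Phi : H ⊗ H ⊗ H;
  Phi_inv : H ⊗ H ⊗ H;
  antipode : {linear H -> H};
  alpha : H;
  beta : H;
  Phi_mulV : Phi * Phi_inv = 1;
  Phi_mulVl : Phi_inv * Phi = 1;
  antipode1 : antipode 1 = 1;
  antipodeM : forall x y, antipode (x * y) = antipode y * antipode x;
  Phi_pentagon :
    tsum3 (fun a b c => 1 ⊗ a ⊗ b ⊗ c) Phi
    * tsum3 (fun a b c => tsum (fun b' b'' => a ⊗ b' ⊗ b'' ⊗ c) (Delta b)) Phi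
    * (Phi ⊗ 1)
    = tsum3 (fun a b c => tsum (fun c' c'' => a ⊗ b ⊗ c' ⊗ c'') (Delta c)) Phi
      * tsum3 (fun a b c => Delta a ⊗ b ⊗ c) Phi;
  quasi_coassoc : forall x,
    Phi * tsum (fun a b => Delta a ⊗ b) (Delta x)
    = tsum (fun a b => tsum (fun b' b'' => a ⊗ b' ⊗ b'') (Delta b)) (Delta x)
      * Phi;
  Phi_counit : tsum3 (fun a b c => eps b *: (a ⊗ c)) Phi = 1 ⊗ 1;
  counitr : forall x, tsum (fun a b => eps b *: a) (Delta x) = x;
  counitl : forall x, tsum (fun a b => eps a *: b) (Delta x) = x;
  antipodel : forall x,
    tsum (fun a b => antipode a * alpha * b) (Delta x) = eps x *: alpha;
  antipoder : forall x,
    tsum (fun a b => a * beta * antipode b) (Delta x) = eps x *: beta;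
  Phi_antipode :
    tsum3 (fun a b c => a * beta * antipode b * alpha * c) Phi = 1;
  Phi_inv_antipode :
    tsum3 (fun a b c => antipode a * alpha * b * beta * antipode c) Phi_inv = 1;
  eps_alpha : eps alpha = 1;
  eps_beta : eps beta = 1
}.

(* I is a quasi-Hopf ideal of B, where B is H itself (setT) or a quasi-Hopf
   subalgebra of H carrying the restricted structure, B (x) B being identified
   with its image in H (x) H. *)
Record quasiHopf_ideal (K : fieldType) (H : algType K) (Q : quasiHopf H)
    (B I : set H) : Prop := QuasiHopfIdeal {
  qh_ideal_sub : I `<=` B;
  qh_ideal_subspace : subspace I;
  qh_ideal_mull : forall x y, B x -> I y -> I (x * y);
  qh_ideal_mulr : forall x y, I x -> B y -> I (x * y);
  qh_ideal_Delta : forall x, I x ->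
    add_set (tens_set I B) (tens_set B I) (Delta Q x);
  qh_ideal_eps : forall x, I x -> eps Q x = 0;
  qh_ideal_antipode : forall x, I x -> I (antipode Q x)
}.

Section Grading.
Variables (K : fieldType) (G : groupType) (H : algType K).
Variables (Q : quasiHopf H) (Hg : G -> set H).

Definition is_decomposition (x : H) (d : {fsfun G -> H with 0}) : Prop :=
  (forall g, Hg g (d g)) /\ x = \sum_(g <- finsupp d) d g.

Definition direct_sum : Prop :=
  (forall g, subspace (Hg g)) /\ (forall x, exists! d, is_decomposition x d).

Record graded : Prop := Graded {
  graded_direct : direct_sum;
  graded_mul : forall g h x y, Hg g x -> Hg h y -> Hg (g * h)%g (x * y);
  graded_Delta : forall g x, Hg g x -> tens_set (Hg g) (Hg g) (Delta Q x);
  graded_antipode : forall g x, Hg g x -> Hg g^-1%g (antipode Q x);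
  graded_Phi : tens_set (tens_set (Hg 1%g) (Hg 1%g)) (Hg 1%g) (Phi Q);
  graded_alpha : Hg 1%g (alpha Q);
  graded_beta : Hg 1%g (beta Q)
}.

Definition faithfully_graded : Prop := forall g, exists2 x, Hg g x & x != 0.

(* The homogeneous components of x; meaningful when direct_sum holds. *)
Definition components (x : H) : {fsfun G -> H with 0} :=
  xget [fsfun] [set d | is_decomposition x d].

(* The group algebra K[G] is {malg K[G]}, with zeta_g = << g >>; only its
   vector space structure intervenes. *)
Definition grading_map (x : H) : {malg K[G]} :=
  \sum_(g <- finsupp (components x)) eps Q (components x g) *: << g >>.

Definition augmentation (N : set G) : set {malg K[G]} :=
  lspan [set << n >> - << 1%g >> | n in N].

(* H_(gN), as a function of a representative g of the coset. *)
Definition coset_part (N : set G) (g : G) : set H :=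
  lspan (\bigcup_(n in N) Hg (g * n)%g).

Definition subgroup_part (N : set G) : set H := lspan (\bigcup_(n in N) Hg n).

Definition normal_subgroup (N : set G) : Prop :=
  group_closed (mem N) /\ (forall n g, N n -> N (n ^ g)%g).

Definition ideal_subgroup (I : set H) : set G :=
  [set g | (grading_map @` I) (<< g >> - << 1%g >>)].

Record admissible (N : set G) (J : set H) : Prop := Admissible {
  admissible_normal : normal_subgroup N;
  admissible_ideal : quasiHopf_ideal Q (subgroup_part N) J;
  admissible_invariant : forall g,
    mul_set (coset_part N g) J = mul_set J (coset_part N g);
  admissible_augmentation : augmentation N `<=` grading_map @` J
}.

Definition pair_of_ideal (I : set H) : set G * set H :=
  (ideal_subgroup I, I `&` subgroup_part (ideal_subgroup I)).

(* The sum of all H_(gN) J, the cosets being repeated once per representative. *)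
Definition ideal_of_pair (p : set G * set H) : set H :=
  lspan (\bigcup_(g in [set: G]) mul_set (coset_part p.1 g) p.2).

End Grading.

(* Main.v *)
(* A quasi-Hopf ideal I turns out to be homogeneous for the G/N_I-grading. If f
   is a functional on K[G] vanishing on pi(I), then (id (x) f pi) Delta maps I to
   itself, and by the counit axiom it multiplies H_g by the scalar f(zeta_g).
   These scalar functions on G separate exactly the cosets of N_I, so by Lagrange
   interpolation I is stable under the projections onto the H_(gN_I). The
   antipode axioms give 1 \in H_g H_(g^-1), whence, with K the intersection of I
   and H_(N_I), the equalities I /\ H_(gN_I) = H_(gN_I) K = K H_(gN_I).
   Conversely, for an admissible pair (N, K), the projection of the ideal
   generated by K onto H_N is K itself; since eps vanishes on K, the coefficients
   of pi(x) over N sum to 0 for x in this ideal, which forces N_I = N. *)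
Require Import Defs.
From HB Require Import structures.
From mathcomp Require Import all_boot all_algebra generic_quotient finmap.
From mathcomp Require Import boolp classical_sets functions.
From mathcomp Require Import multinomials.monalg.
Local Open Scope classical_set_scope.

Set Implicit Arguments.
Unset Strict Implicit.
Unset Printing Implicit Defensive.

Import GRing.Theory.
Local Open Scope ring_scope.
Local Open Scope quotient_scope.

(** * Subspaces and tensor products *)

Section SubspaceTheory.
Variable K : fieldType.
Implicit Types U V W : lmodType K.

Lemma subspaceP V (A : set V) :
  subspace A <-> A 0 /\ forall a x y, A x -> A y -> A (a *: x + y).
Proof.
split=> [[A0 AP]|[A0 AP]]; split.
- by rewrite inE in A0.
- by move=> a x y Ax Ay; have := AP a x y; rewrite !inE; apply.
- by rewrite inE.
- by move=> a x y; rewrite !inE; apply: AP.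
Qed.

Lemma subspaceZ V (A : set V) a x : subspace A -> A x -> A (a *: x).
Proof. by move=> /subspaceP[A0 AP] Ax; rewrite -[_ *: _]addr0; apply: AP. Qed.

Lemma subspaceD V (A : set V) x y : subspace A -> A x -> A y -> A (x + y).
Proof. by move=> /subspaceP[_ AP] Ax; rewrite -[x]scale1r; apply: AP. Qed.

Lemma subspaceN V (A : set V) x : subspace A -> A x -> A (- x).
Proof. by move=> As Ax; rewrite -scaleN1r; apply: subspaceZ. Qed.

Lemma subspaceB V (A : set V) x y : subspace A -> A x -> A y -> A (x - y).
Proof. by move=> As Ax Ay; apply: subspaceD => //; apply: subspaceN. Qed.

Lemma subspace_set1 V : subspace [set (0 : V)].
Proof. by apply/subspaceP; split=> // a x y -> ->; rewrite scaler0 add0r. Qed.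

Lemma subspaceI V (A B : set V) : subspace A -> subspace B -> subspace (A `&` B).
Proof.
move=> /subspaceP[A0 AP] /subspaceP[B0 BP]; apply/subspaceP; split=> //.
by move=> a x y [Ax Bx] [Ay By]; split; [apply: AP | apply: BP].
Qed.

Lemma linear_0 V W (f : V -> W) : linear f -> f 0 = 0.
Proof.
by move=> fl; have := fl (-1) 0 0;
  rewrite !scaleN1r !oppr0 !addr0 => ->; rewrite addNr.
Qed.

Lemma subspace_preimage V W (f : V -> W) (A : set W) :
  linear f -> subspace A -> subspace [set x | A (f x)].
Proof.
move=> fl /subspaceP[A0 AP]; apply/subspaceP; split=> /=.
  by rewrite linear_0.
by move=> a x y Ax Ay; rewrite fl; apply: AP.
Qed.

Lemma subspace_image V W (f : V -> W) (A : set V) :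
  linear f -> subspace A -> subspace (f @` A).
Proof.
move=> fl /subspaceP[A0 AP]; apply/subspaceP; split=> [|a _ _ [x Ax <-] [y Ay <-]].
  by exists 0; rewrite ?linear_0.
by exists (a *: x + y); rewrite ?fl //; apply: AP.
Qed.

Lemma subspace_eq V W (f g : V -> W) :
  linear f -> linear g -> subspace [set x | f x = g x].
Proof.
move=> fl gl; apply/subspaceP; split=> /=; first by rewrite !linear_0.
by move=> a x y fgx fgy; rewrite fl gl fgx fgy.
Qed.

Lemma lspan_subspace V (A : set V) : subspace (lspan A).
Proof.
apply/subspaceP; split=> [B [/subspaceP[] //]|a x y Ax Ay B BP].
by have /subspaceP[_] := BP.1; apply; [apply: Ax | apply: Ay].
Qed.

Lemma sub_lspan V (A : set V) : A `<=` lspan A.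
Proof. exact: sub_gen_smallest. Qed.

Lemma lspan_min V (A B : set V) : subspace B -> A `<=` B -> lspan A `<=` B.
Proof. exact: smallest_sub. Qed.

Lemma tens_set_tens U V (A : set U) (B : set V) x y :
  A x -> B y -> tens_set A B (x ⊗ y).
Proof. by move=> Ax By; apply: sub_lspan; exists x => //; exists y. Qed.

Lemma tens_setS U V (A A' : set U) (B B' : set V) :
  A `<=` A' -> B `<=` B' -> tens_set A B `<=` tens_set A' B'.
Proof.
move=> sA sB; apply: lspan_min; first exact: lspan_subspace.
by move=> _ [x Ax [y By <-]]; apply: tens_set_tens; [apply: sA | apply: sB].
Qed.

(** [tsum f] is linear when [f] is bilinear, so only pure tensors have to be checked. This is how
    the grading and ideal conditions on [Delta Q x] are put to use. *)
Lemma tsum_tens_set U V W (A : set U) (B : set V) (C : set W) f t :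
  bilin f -> subspace C -> (forall x y, A x -> B y -> C (f x y)) ->
  tens_set A B t -> C (tsum f t).
Proof.
move=> bf Cs ABC; move: t; apply: lspan_min.
  by apply: subspace_preimage => //; apply: tsum_linear.
by move=> _ [x Ax [y By <-]] /=; rewrite tsum_tens //; apply: ABC.
Qed.

Lemma eq_tsum_tens_set U V W (A : set U) (B : set V) (f g : U -> V -> W) t :
  bilin f -> bilin g -> (forall x y, A x -> B y -> f x y = g x y) ->
  tens_set A B t -> tsum f t = tsum g t.
Proof.
move=> bf bg ABfg; move: t; apply: lspan_min.
  by apply: subspace_eq; apply: tsum_linear.
by move=> _ [x Ax [y By <-]] /=; rewrite !tsum_tens // ABfg.
Qed.

(** Turns a tensor into a Sweedler sum, so that its factors can be rewritten by
    [eq_tsum_tens_set]. *)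
Lemma tsum_id U V (t : U ⊗ V) : tsum (fun x y => x ⊗ y) t = t.
Proof.
apply: tsum_ext => W f bf.
elim/tens_ind: t => [|u v t IH]; first by rewrite tsum0 //; apply: tens_bilin.
by rewrite (tsumD _ _ (@tens_bilin K U V)) tsum_tens ?tsumD ?IH //; apply: tens_bilin.
Qed.

Lemma bilin_comp U U' V V' W (f : U' -> V' -> W) (p : U -> U') (q : V -> V') :
  bilin f -> linear p -> linear q -> bilin (fun x y => f (p x) (q y)).
Proof.
move=> [fl fr] pl ql; split=> [v a x y | u a x y].
  by rewrite pl; apply: fl.
by rewrite ql; apply: fr.
Qed.

Lemma bilin_scale V W (f : V -> K) : linear (f : V -> K^o) ->
  bilin (fun (x : W) (y : V) => f y *: x).
Proof.
move=> fl; split=> [v a x y | u a x y].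
  by rewrite scalerDr !scalerA mulrC.
by rewrite fl scalerDl scalerA.
Qed.

Lemma add_set_subspace V (A B : set V) :
  subspace A -> subspace B -> subspace (add_set A B).
Proof.
move=> /subspaceP[A0 AP] /subspaceP[B0 BP]; apply/subspaceP; split.
  by exists 0 => //; exists 0; rewrite ?addr0.
move=> a _ _ [x Ax [y By <-]] [x' Ax' [y' By' <-]].
exists (a *: x + x'); first exact: AP.
by exists (a *: y + y'); rewrite ?scalerDr 1?addrACA //; apply: BP.
Qed.

Lemma sub_add_set V (A B C : set V) : subspace C ->
  A `<=` C -> B `<=` C -> add_set A B `<=` C.
Proof.
by move=> Cs sAC sBC _ [x Ax [y By <-]]; apply: subspaceD; [|apply: sAC|apply: sBC].
Qed.

Lemma sub_add_setl V (A B : set V) : subspace B -> A `<=` add_set A B.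
Proof.
by move=> /subspaceP[B0 _] x Ax; exists x => //; exists 0; rewrite ?addr0.
Qed.

Lemma sub_add_setr V (A B : set V) : subspace A -> B `<=` add_set A B.
Proof.
by move=> /subspaceP[A0 _] x Bx; exists 0 => //; exists x; rewrite ?add0r.
Qed.

End SubspaceTheory.

(** * Functionals vanishing on a subspace *)

Section Quotient.
Variables (K : fieldType) (V : lmodType K) (A : set V) (As : subspace A).

Definition eqmod_subspace (x y : V) : bool := `[< A (x - y) >].

Lemma eqmod_subspace_refl : reflexive eqmod_subspace.
Proof. by move=> x; apply/asboolP; rewrite subrr; case/subspaceP: As. Qed.

Lemma eqmod_subspace_sym : symmetric eqmod_subspace.
Proof.
by move=> x y; apply/asboolP/asboolP => h; rewrite -opprB; apply: subspaceN.
Qed.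

Lemma eqmod_subspace_trans : transitive eqmod_subspace.
Proof.
move=> y x z /asboolP xy /asboolP yz; apply/asboolP.
by rewrite -[x](subrK y) -addrA; apply: subspaceD.
Qed.

Canonical eqmod_subspace_equiv := EquivRel eqmod_subspace
  eqmod_subspace_refl eqmod_subspace_sym eqmod_subspace_trans.

Definition quot := {eq_quot eqmod_subspace}.
HB.instance Definition _ := Choice.on quot.
Definition to_quot (x : V) : quot := \pi x.

Lemma to_quotP x y : reflect (A (x - y)) (to_quot x == to_quot y).
Proof.
apply: (iffP eqP) => [/eqmodP /asboolP //|Axy].
by apply/eqmodP/asboolP.
Qed.

Definition quot_add (x y : quot) : quot := to_quot (repr x + repr y).
Definition quot_scale (a : K) (x : quot) : quot := to_quot (a *: repr x).

Lemma quotW (P : quot -> Prop) : (forall x, P (to_quot x)) -> forall x, P x.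
Proof. by move=> h x; rewrite -[x]reprK; apply: h. Qed.

Lemma repr_to_quot x : A (repr (to_quot x) - x).
Proof. by apply/to_quotP/eqP; rewrite /to_quot reprK. Qed.

Lemma to_quotD x y : to_quot (x + y) = quot_add (to_quot x) (to_quot y).
Proof.
apply/esym/eqP/to_quotP; rewrite opprD addrACA.
by apply: subspaceD => //; apply: repr_to_quot.
Qed.

Lemma to_quotZ a x : to_quot (a *: x) = quot_scale a (to_quot x).
Proof.
apply/esym/eqP/to_quotP; rewrite -scalerBr.
by apply: subspaceZ => //; apply: repr_to_quot.
Qed.

Fact quot_addA : associative quot_add.
Proof.
by elim/quotW=> x; elim/quotW=> y; elim/quotW=> z; rewrite -!to_quotD addrA.
Qed.
Fact quot_addC : commutative quot_add.
Proof. by elim/quotW=> x; elim/quotW=> y; rewrite -!to_quotD addrC. Qed.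
Fact quot_add0 : left_id (to_quot 0) quot_add.
Proof. by elim/quotW=> x; rewrite -to_quotD add0r. Qed.
Fact quot_addN : left_inverse (to_quot 0) (quot_scale (-1)) quot_add.
Proof. by elim/quotW=> x; rewrite -to_quotZ -to_quotD scaleN1r addNr. Qed.
HB.instance Definition _ :=
  GRing.isZmodule.Build quot quot_addA quot_addC quot_add0 quot_addN.

Fact quot_scaleA a b x : quot_scale a (quot_scale b x) = quot_scale (a * b) x.
Proof. by elim/quotW: x => x; rewrite -!to_quotZ scalerA. Qed.
Fact quot_scale1 : left_id 1 quot_scale.
Proof. by elim/quotW=> x; rewrite -!to_quotZ scale1r. Qed.
Fact quot_scaleDr : right_distributive quot_scale +%R.
Proof.
move=> a; elim/quotW=> x; elim/quotW=> y.
by rewrite -[_ + _ in LHS]to_quotD -!to_quotZ scalerDr to_quotD.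
Qed.
Fact quot_scaleDl x : {morph quot_scale^~ x : a b / a + b}.
Proof. by elim/quotW: x => x a b; rewrite -!to_quotZ scalerDl to_quotD. Qed.
HB.instance Definition _ := GRing.Zmodule_isLmodule.Build K quot
  quot_scaleA quot_scale1 quot_scaleDr quot_scaleDl.

(** The class of [v] in V/A is nonzero, so some functional on the quotient does not kill it; its
    pullback to V vanishes on [A]. *)
Lemma subspace_separation v : ~ A v ->
  exists p : V -> K,
    [/\ linear (p : V -> K^o), forall x, A x -> p x = 0 & p v != 0].
Proof.
move=> nAv; have v0 : to_quot v != 0.
  by apply/negP=> /to_quotP; rewrite subr0.
have [p pv] := linear_form_neq0 v0.
exists (fun x => p (to_quot x)); split=> //.
  by move=> a x y; rewrite to_quotD to_quotZ [LHS](linearP p).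
move=> x Ax; have /eqP -> : to_quot x == to_quot 0 by apply/to_quotP; rewrite subr0.
exact: (linear0 p).
Qed.

End Quotient.

(** * Products of subspaces of an algebra *)

Section ProductSets.
Variables (K : fieldType) (A : algType K).
Implicit Types (U V W : set A).

Lemma mul_setM U V x y : U x -> V y -> mul_set U V (x * y).
Proof. by move=> Ux Vy; apply: sub_lspan; exists x => //; exists y. Qed.

Lemma mul_set_min U V W : subspace W ->
  (forall x y, U x -> V y -> W (x * y)) -> mul_set U V `<=` W.
Proof. by move=> Ws UVW; apply: lspan_min => // _ [x Ux [y Vy <-]]; apply: UVW. Qed.

Lemma mull_linear (x : A) : linear ( *%R x).
Proof. by move=> a y z; rewrite mulrDr scalerAr. Qed.

Lemma mulr_linear (x : A) : linear ( *%R^~ x).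
Proof. by move=> a y z; rewrite mulrDl scalerAl. Qed.

Lemma mul_set_mulr U V W' x y : subspace W' ->
  (forall u v, U u -> V v -> W' (u * v * y)) -> mul_set U V x -> W' (x * y).
Proof.
move=> Ws h; move: x; apply: lspan_min; last by move=> _ [u Uu [v Vv <-]]; apply: h.
by apply: (subspace_preimage (mulr_linear y)).
Qed.

Lemma mul_set_mull U V W' x y : subspace W' ->
  (forall u v, U u -> V v -> W' (y * (u * v))) -> mul_set U V x -> W' (y * x).
Proof.
move=> Ws h; move: x; apply: lspan_min; last by move=> _ [u Uu [v Vv <-]]; apply: h.
by apply: (subspace_preimage (mull_linear y)).
Qed.

End ProductSets.

(** * Gradings *)

Section Graded.
Variables (K : fieldType) (G : groupType) (H : algType K) (Hg : G -> set H).
Hypothesis Hdir : direct_sum Hg.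

Lemma Hg_subspace g : subspace (Hg g).
Proof. exact: Hdir.1. Qed.

Lemma Hg0 g : Hg g 0.
Proof. by case/subspaceP: (Hg_subspace g). Qed.

Lemma componentsP x : is_decomposition Hg x (components Hg x).
Proof. by apply: xgetPex; have [d [Pd _]] := Hdir.2 x; exists d. Qed.

Lemma components_hom x g : Hg g (components Hg x g).
Proof. exact: (componentsP x).1. Qed.

Lemma sum_components x :
  x = \sum_(g <- finsupp (components Hg x)) components Hg x g.
Proof. exact: (componentsP x).2. Qed.

(** Uniqueness of the decomposition, in a form where the index set [A] may be larger than the
    support of [e]. *)
Lemma components_sum (A : {fset G}) (e : G -> H) :
  (forall g, Hg g (e g)) -> (forall g, g \notin A -> e g = 0) ->
  components Hg (\sum_(g <- A) e g) =1 e.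
Proof.
move=> eH eA; pose d : {fsfun G -> H with 0} := [fsfun g in A => e g].
have dE g : d g = e g by rewrite fsfunE; case: ifPn => // /eA.
have dP : is_decomposition Hg (\sum_(g <- A) e g) d.
  split=> [g|]; first by rewrite dE.
  under eq_bigr do rewrite -dE; apply/esym/big_fset_incl => [|g _].
    by apply/fsubsetP => g; rewrite mem_finsupp dE; apply: contraR => /eA ->.
  by rewrite memNfinsupp => /eqP.
have [d' [_ uniq]] := Hdir.2 (\sum_(g <- A) e g) => g.
by rewrite -(uniq _ (componentsP _)) (uniq _ dP) dE.
Qed.

(* K^G is the dual of K[G], so this is the action of functions on G that comes
   from the coaction x |-> x (x) zeta_g of K[G] on H. *)
Definition mult (c : G -> K) (x : H) : H :=
  \sum_(g <- finsupp (components Hg x)) c g *: components Hg x g.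

Lemma mult_fset (A : {fset G}) c x : (finsupp (components Hg x) `<=` A)%fset ->
  mult c x = \sum_(g <- A) c g *: components Hg x g.
Proof.
move=> sA; apply: big_fset_incl => // g _.
by rewrite memNfinsupp => /eqP ->; rewrite scaler0.
Qed.

Lemma components_linear g : linear (components Hg ^~ g).
Proof.
move=> a x y; pose A := (finsupp (components Hg x) `|` finsupp (components Hg y))%fset.
have -> : a *: x + y = \sum_(h <- A) (a *: components Hg x h + components Hg y h).
  rewrite big_split -scaler_sumr [in LHS](sum_components x) [in LHS](sum_components y).
  by congr (_ *: _ + _); apply: big_fset_incl; rewrite ?fsubsetUl ?fsubsetUr // => h _;
    rewrite memNfinsupp => /eqP.
apply: components_sum => h; first by case/subspaceP: (Hg_subspace h) => _; apply;
  apply: components_hom.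
by rewrite in_fsetU negb_or !memNfinsupp => /andP[/eqP-> /eqP->]; rewrite scaler0 addr0.
Qed.

Lemma mult_is_linear c : linear (mult c).
Proof.
move=> a x y; pose A := (finsupp (components Hg x) `|` finsupp (components Hg y)
  `|` finsupp (components Hg (a *: x + y)))%fset.
rewrite !(@mult_fset A); first last.
- by rewrite /A fsubsetUr.
- by rewrite /A -fsetUA fsubsetUl.
- by rewrite /A (fsetUC (finsupp (components Hg x))) -fsetUA fsubsetUl.
rewrite scaler_sumr -big_split; apply: eq_bigr => h _ /=.
by rewrite components_linear scalerDr !scalerA mulrC.
Qed.

HB.instance Definition _ c :=
  GRing.isLinear.Build K H H *:%R (mult c) (mult_is_linear c).

Lemma components_homE g x : Hg g x ->
  components Hg x =1 fun h => if h == g then x else 0.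
Proof.
move=> gx h; have {1}-> : x = \sum_(h <- [fset g]%fset) (if h == g then x else 0).
  by rewrite big_seq_fset1 eqxx.
apply: components_sum => {}h; first by case: eqP => [->|_] //; apply: Hg0.
by rewrite in_fset1 => /negPf ->.
Qed.

Lemma mult_hom c g x : Hg g x -> mult c x = c g *: x.
Proof.
move=> gx; rewrite (@mult_fset [fset g]%fset).
  by rewrite big_seq_fset1 (components_homE gx) eqxx.
apply/fsubsetP => h; rewrite mem_finsupp (components_homE gx) in_fset1.
by apply: contraR => /negPf ->.
Qed.

Lemma hom_ind (P : H -> Prop) : (forall x y, P x -> P y -> P (x + y)) ->
  (forall g x, Hg g x -> P x) -> forall x, P x.
Proof.
move=> PD Pg x; rewrite [x]sum_components; elim/big_ind: _ => //.
  (* The empty sum is an instance of the homogeneous case, 0 having degree $e$. *)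
  exact: (Pg 1%g 0 (Hg0 _)).
by move=> g _; apply: (Pg g); apply: components_hom.
Qed.

Lemma eq_linear_hom (W : lmodType K) (f f' : H -> W) : linear f -> linear f' ->
  (forall g x, Hg g x -> f x = f' x) -> forall x, f x = f' x.
Proof.
move=> fl fl' ff'; elim/hom_ind => [x y|g x gx]; last exact: ff' gx.
exact: subspaceD (subspace_eq fl fl').
Qed.

Lemma components_mult c x g :
  components Hg (mult c x) g = c g *: components Hg x g.
Proof.
apply: (components_sum (A := finsupp (components Hg x))
          (e := fun g => c g *: components Hg x g)) => h.
  exact: subspaceZ (Hg_subspace h) (components_hom x h).
by rewrite memNfinsupp => /eqP ->; rewrite scaler0.
Qed.

Lemma mult_comp c d x : mult c (mult d x) = mult (fun g => c g * d g) x.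
Proof.
elim/hom_ind: x => [x y IHx IHy|g x gx]; first by rewrite !linearD /= IHx IHy.
rewrite !(mult_hom _ gx) (@mult_hom _ g) ?scalerA //.
exact: subspaceZ (Hg_subspace g) gx.
Qed.

Lemma mult_const a x : mult (fun=> a) x = a *: x.
Proof. by rewrite /mult -scaler_sumr -sum_components. Qed.

Lemma multD c d x : mult (fun g => c g + d g) x = mult c x + mult d x.
Proof. by rewrite /mult -big_split; apply: eq_bigr => g _; rewrite scalerDl. Qed.

(** Only finitely many values of [c] matter for a given [x]; this makes interpolation possible over
    an infinite group. *)
Lemma eq_mult c d x :
  {in finsupp (components Hg x), c =1 d} -> mult c x = mult d x.
Proof. by move=> cd; apply: eq_big_seq => g /cd ->. Qed.

(** The indicator function of [C], so that [mult (delta C)] is the projection of H onto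
    [hpart C]. *)
Definition delta (C : set G) (g : G) : K := `[< C g >]%:R.

Lemma delta_in (C : set G) g : C g -> delta C g = 1.
Proof. by move=> Cg; rewrite /delta asboolT. Qed.

Lemma delta_notin (C : set G) g : ~ C g -> delta C g = 0.
Proof. by move=> Cg; rewrite /delta asboolF. Qed.

(** One notion for both $H_N$ and $H_{gN}$: [subgroup_part Hg N] unfolds to [hpart N], and
    [coset_partE] treats the cosets. *)
Definition hpart (C : set G) : set H := lspan (\bigcup_(g in C) Hg g).

Lemma hpart_subspace C : subspace (hpart C).
Proof. exact: lspan_subspace. Qed.

Lemma hom_hpart (C : set G) g x : C g -> Hg g x -> hpart C x.
Proof. by move=> Cg gx; apply: sub_lspan; exists g. Qed.

Lemma hpart_min (C : set G) (W : set H) : subspace W ->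
  (forall g x, C g -> Hg g x -> W x) -> hpart C `<=` W.
Proof. by move=> Ws h; apply: lspan_min => // x [g Cg gx]; apply: (h g). Qed.

Lemma hpartS (C D : set G) : C `<=` D -> hpart C `<=` hpart D.
Proof.
by move=> CD; apply: hpart_min (hpart_subspace D) _ => g x /CD; apply: hom_hpart.
Qed.

Lemma mult_hpart C x : hpart C x -> mult (delta C) x = x.
Proof.
move: x; apply: hpart_min; first by apply: subspace_eq => //; apply: linearP.
by move=> g x Cg gx; rewrite /= (mult_hom _ gx) delta_in // scale1r.
Qed.

Lemma mult_hpart0 C D x : (forall g, C g -> ~ D g) -> hpart C x ->
  mult (delta D) x = 0.
Proof.
move=> CD; move: x; apply: hpart_min.
  exact: (subspace_preimage (mult_is_linear (delta D)) (subspace_set1 H)).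
by move=> g x /CD Dg gx; rewrite /= (mult_hom _ gx) delta_notin // scale0r.
Qed.

Lemma hpart_mult C x : hpart C (mult (delta C) x).
Proof.
elim/hom_ind: x => [x y Cx Cy|g x gx].
  by rewrite linearD /=; exact: subspaceD (hpart_subspace _) Cx Cy.
rewrite (mult_hom _ gx); have [Cg|Cg] := pselect (C g).
  by rewrite delta_in // scale1r; apply: hom_hpart gx.
by rewrite delta_notin // scale0r; case/subspaceP: (hpart_subspace C).
Qed.

(** Induction on a list [s] containing the support of [x]: subtracting the projection onto
    [hpart (F g)] stays in [I], adds no degree to the support and removes [g], because [g] belongs
    to [F g]. *)
Lemma sub_lspan_hpart (I : set H) (F : G -> set G) :
  subspace I -> (forall g, F g g) ->
  (forall g x, I x -> I (mult (delta (F g)) x)) ->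
  I `<=` lspan (\bigcup_(g in [set: G]) (I `&` hpart (F g))).
Proof.
move=> Is Frefl IF x Ix; pose s : seq G := finsupp (components Hg x).
have : {subset finsupp (components Hg x) <= s} by [].
move: s => s; elim: s x Ix => [|g s IH] x Ix xs.
  rewrite [x]sum_components big1_seq => [|g /andP[_ /xs]//].
  by case/subspaceP: (lspan_subspace (\bigcup_(g in setT) (I `&` hpart (F g)))).
rewrite -[x](subrK (mult (delta (F g)) x)).
apply: (subspaceD (lspan_subspace _)).
- apply: IH => [|h]; first exact: subspaceB Is Ix (IF _ _ Ix).
  (* The difference is again a multiplier, namely $1-\delta$, whose effect on components is
     known. *)
  have -> : x - mult (delta (F g)) x = mult (fun h => 1 + (- 1) * delta (F g) h) x.
    rewrite multD mult_const scale1r -(mult_comp (fun=> -1) (delta (F g))).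
    by rewrite mult_const scaleN1r.
  rewrite mem_finsupp components_mult => hx.
  have : h \in g :: s.
    by apply: xs; rewrite mem_finsupp; apply: contraNneq hx => ->; rewrite scaler0.
  rewrite inE => /predU1P[hg|//]; move: hx.
  by rewrite hg delta_in ?mulr1 ?subrr ?scale0r ?eqxx.
- by apply: sub_lspan; exists g => //; split; [apply: IF|apply: hpart_mult].
Qed.

Definition lcos (N : set G) (g : G) : set G := [set h | N (g^-1 * h)%g].

Lemma coset_partE N g : coset_part Hg N g = hpart (lcos N g).
Proof.
congr lspan; apply/seteqP; split=> x [h Nh hx].
  by exists (g * h)%g => //; rewrite /lcos /= mulKg.
by exists (g^-1 * h)%g => //; rewrite mulVKg.
Qed.

Section GradedAlgebra.
Hypothesis HgM : forall g h x y, Hg g x -> Hg h y -> Hg (g * h)%g (x * y).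

Lemma hpartM (C D E : set G) x y : (forall c d, C c -> D d -> E (c * d)%g) ->
  hpart C x -> hpart D y -> hpart E (x * y).
Proof.
move=> CDE Cx Dy; move: x Cx; apply: hpart_min => [|c x Cc cx].
  exact: subspace_preimage (mulr_linear y) (hpart_subspace E).
move: y Dy; apply: hpart_min => [|d y Dd dy].
  exact: subspace_preimage (mull_linear x) (hpart_subspace E).
exact: hom_hpart (CDE _ _ Cc Dd) (HgM cx dy).
Qed.

Lemma components_mull a u x c : Hg a u ->
  components Hg (u * x) c = u * components Hg x (a^-1 * c)%g.
Proof.
move=> au; move: x; apply: eq_linear_hom => [k x y|k x y|h x hx].
- by rewrite mull_linear components_linear.
- by rewrite components_linear mull_linear.
rewrite (components_homE hx) (components_homE (HgM au hx)).
have -> : (a^-1 * c == h)%g = (c == a * h)%g by rewrite -(inj_eq (mulgI a)) mulVKg.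
by case: eqP => // _; rewrite mulr0.
Qed.

Lemma components_mulr a u x c : Hg a u ->
  components Hg (x * u) c = components Hg x (c * a^-1)%g * u.
Proof.
move=> au; move: x; apply: eq_linear_hom => [k x y|k x y|h x hx].
- by rewrite mulr_linear components_linear.
- by rewrite components_linear mulr_linear.
rewrite (components_homE hx) (components_homE (HgM hx au)).
have -> : (c * a^-1 == h)%g = (c == h * a)%g by rewrite -(inj_eq (mulIg a)) mulgVK.
by case: eqP => // _; rewrite mul0r.
Qed.

End GradedAlgebra.

(** * Graded quasi-Hopf algebras *)

Section GradedQuasiHopf.
Variables (Q : quasiHopf H).
Hypothesis (HQ : graded Q Hg) (Hfaith : faithfully_graded Hg).

Let HgM := graded_mul HQ.

Lemma eps_linear : linear (eps Q : H -> K^o).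
Proof. by move=> a x y; apply: (linearP (eps Q)). Qed.

(** If the counit vanished on $H_g$, then $x=\varepsilon(x'')x'$ with $x''\in H_g$ would force
    $H_g=0$, against faithfulness. Such a [u] is a preimage of $\zeta_g$ under the grading map. *)
Lemma exists_eps1 g : exists2 u, Hg g u & eps Q u = 1.
Proof.
have [x gx x0] := Hfaith g.
have [y gy y0] : exists2 y, Hg g y & eps Q y != 0.
  apply: contrapT => h; move/eqP: x0; apply.
  rewrite -(counitr Q x).
  apply: (tsum_tens_set _ (subspace_set1 H) _ (graded_Delta HQ gx)).
    exact: bilin_scale _ eps_linear.
  move=> a b _ gb; have [->|b0] := eqVneq (eps Q b) 0; first by rewrite scale0r.
  by case: h; exists b.
exists ((eps Q y)^-1 *: y); first exact: subspaceZ (Hg_subspace g) gy.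
by rewrite [LHS](linearZ_LR (eps Q)) /= mulVf.
Qed.

Lemma mul_set_Hg_id g x y : mul_set (Hg g) (Hg g^-1%g) x ->
  Hg 1%g y -> mul_set (Hg g) (Hg g^-1%g) (x * y).
Proof.
move=> + ey; apply: (mul_set_mulr (lspan_subspace _)).
move=> u v gu gv; rewrite -mulrA; apply: mul_setM => //.
by rewrite -[X in Hg X]mulg1; apply: HgM.
Qed.

Lemma mul_id_set_Hg g x y : mul_set (Hg g) (Hg g^-1%g) x ->
  Hg 1%g y -> mul_set (Hg g) (Hg g^-1%g) (y * x).
Proof.
move=> + ey; apply: (mul_set_mull (lspan_subspace _)).
move=> u v gu gv; rewrite mulrA; apply: mul_setM => //.
by rewrite -[X in Hg X]mul1g; apply: HgM.
Qed.

(** For $u\in H_g$ with $\varepsilon(u)=1$, the axiom $u'\beta S(u'')=\beta$ puts $\beta$ in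
    $H_gH_{g^{-1}}$. This space is stable under $H_e$ on both sides, so it contains $\Phi^{(1)}\beta
    S(\Phi^{(2)})\alpha\Phi^{(3)}=1$. *)
Lemma mul_set_Hg1 g : mul_set (Hg g) (Hg g^-1%g) 1.
Proof.
pose M := mul_set (Hg g) (Hg g^-1%g).
have Ms : subspace M by exact: lspan_subspace.
have antl := linearP (antipode Q).
have Mbeta : M (beta Q).
  have [u gu u1] := exists_eps1 g.
  rewrite -[beta Q]scale1r -u1 -antipoder.
  apply: (tsum_tens_set _ Ms _ (graded_Delta HQ gu)).
    split=> [v a x y | w a x y] /=; first by rewrite !mulrDl -!scalerAl.
    by rewrite antl mulrDr -scalerAr.
  move=> x y gx gy; rewrite -mulrA; apply: mul_setM => //.
  rewrite -[X in Hg X]mul1g; apply: HgM (graded_beta HQ) _.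
  exact: (graded_antipode HQ).
rewrite -(Phi_antipode Q).
pose f (a b c : H) := a * beta Q * antipode Q b * alpha Q * c.
have f12 c : bilin (fun a b => f a b c).
  split=> [v a x y | w a x y]; rewrite /f.
    by rewrite !mulrDl -!scalerAl.
  by rewrite antl mulrDr !mulrDl -scalerAr -!scalerAl.
apply: (tsum_tens_set _ Ms _ (graded_Phi HQ)).
  split=> [w | u k w w']; first exact: tsum_linear (f12 w).
  rewrite /tsum /fsum scaler_sumr -big_split.
  by apply: eq_bigr => p _; rewrite /= mulrDr -scalerAr.
move=> t c tee ec; apply: (tsum_tens_set (f12 c) Ms _ tee) => a b ea eb.
apply: mul_set_Hg_id => //; apply: mul_set_Hg_id; last exact: graded_alpha HQ.
apply: mul_set_Hg_id; first exact: mul_id_set_Hg.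
by rewrite -[X in Hg X]invg1; apply: graded_antipode HQ _ _ eb.
Qed.

Lemma Delta_hpart C x : hpart C x -> tens_set (hpart C) (hpart C) (Delta Q x).
Proof.
move: x; apply: hpart_min.
  exact: subspace_preimage (linearP (Delta Q)) (lspan_subspace _).
move=> g x Cg gx; apply: tens_setS (graded_Delta HQ gx) => y; exact: hom_hpart.
Qed.

Lemma antipode_hpart (C : set G) x :
  hpart C x -> hpart [set g | C g^-1%g] (antipode Q x).
Proof.
move: x; apply: hpart_min.
  exact: subspace_preimage (linearP (antipode Q)) (hpart_subspace _).
move=> g x Cg gx; apply: hom_hpart (graded_antipode HQ gx).
by rewrite /= invgK.
Qed.

Local Notation pi := (grading_map Q Hg).

Lemma mcoeff_grading_map x g : (pi x)@_g = eps Q (components Hg x g).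
Proof.
rewrite /grading_map raddf_sum /=.
under eq_bigr do rewrite mcoeffZ mcoeffU.
have [gx|gx] := boolP (g \in finsupp (components Hg x)).
  rewrite (bigD1_seq g) //= eqxx mulr1 big1 ?addr0 // => h /negPf ->.
  by rewrite mulr0.
rewrite big1_seq => [|h /andP[_ hx]]; last first.
  by case: eqP hx gx => [-> ->|]; rewrite ?mulr0.
by move: gx; rewrite memNfinsupp => /eqP ->; rewrite (linear0 (eps Q)).
Qed.

Lemma grading_map_linear : linear pi.
Proof.
move=> a x y; apply/malgP => g.
rewrite mcoeffD mcoeffZ !mcoeff_grading_map components_linear.
by rewrite [LHS](linearP (eps Q)).
Qed.

Lemma grading_map_hom g x : Hg g x -> pi x = eps Q x *: << g >>.
Proof.
move=> gx; apply/malgP => h; rewrite mcoeffZ mcoeffU mcoeff_grading_map.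
rewrite (components_homE gx) eq_sym; case: eqP; rewrite ?mulr1 ?mulr0 //.
by rewrite (linear0 (eps Q)).
Qed.

(* Applying a functional f of K[G] after the grading map to the second factor
   of Delta x acts on H_g as the scalar f (zeta_g), by the counit axiom. *)
Lemma mult_functional (f : {malg K[G]} -> K) x : linear (f : _ -> K^o) ->
  mult (fun g => f << g >>) x = tsum (fun a b => f (pi b) *: a) (Delta Q x).
Proof.
move=> fl; have fpl : linear (fun b => f (pi b) : K^o).
  by move=> a u v; rewrite grading_map_linear fl.
have fpb : bilin (fun a b : H => f (pi b) *: a) by exact: bilin_scale _ fpl.
move: x; apply: eq_linear_hom => [||g x gx]; first exact: mult_is_linear.
  by move=> a x y; rewrite (linearP (Delta Q)) tsum_linear.
have fel : linear (fun b => f << g >> * eps Q b : K^o).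
  by move=> a u v; rewrite (linearP (eps Q)) mulrDr /= mulrCA.
rewrite (mult_hom _ gx) -[in LHS](counitr Q x).
rewrite (eq_tsum_tens_set fpb (bilin_scale _ fel) _ (graded_Delta HQ gx)).
  by rewrite /tsum /fsum scaler_sumr; apply: eq_bigr => p _; rewrite scalerA.
move=> a b _ gb; rewrite (grading_map_hom gb).
by rewrite -[_ *: << _ >>]addr0 fl (linear_0 fl) addr0 mulrC.
Qed.

Lemma mul_set_hpart1 (N : set G) g : N 1%g ->
  mul_set (hpart (lcos N g)) (Hg g^-1%g) 1.
Proof.
move=> N1; apply: (mul_set_min (lspan_subspace _) _ (@mul_set_Hg1 g)).
move=> x y gx gy; apply: mul_setM gy; apply: hom_hpart gx.
by rewrite /lcos /= mulVg.
Qed.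

Lemma lcos1 N : lcos N 1%g = N.
Proof. by apply/seteqP; split=> g; rewrite /lcos /= invg1 mul1g. Qed.

Lemma lcos_refl N g : N 1%g -> lcos N g g.
Proof. by rewrite /lcos /= mulVg. Qed.

(** * Cosets of a normal subgroup *)

Section NormalSubgroup.
Variables (N : set G) (Nn : normal_subgroup N).

Lemma normal_subgroup1 : N 1%g.
Proof. by have := Nn.1.1; rewrite inE. Qed.

Lemma normal_subgroupV n : N n -> N n^-1%g.
Proof. by move=> Nx; have := group_closedV Nn.1 (x := n); rewrite !inE; apply. Qed.

Lemma normal_subgroupM m n : N m -> N n -> N (m * n)%g.
Proof.
move=> Nx Ny; have := group_closedM Nn.1 (x := m) (y := n).
by rewrite !inE; apply.
Qed.

Lemma lcosM g h a b : lcos N g a -> lcos N h b -> lcos N (g * h)%g (a * b)%g.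
Proof.
move=> ga hb; rewrite /lcos /=.
(* Moving $g^{-1}a$ past $h$ conjugates it, whence the use of normality. *)
have -> : ((g * h)^-1 * (a * b) = (g^-1 * a) ^ h * (h^-1 * b))%g.
  by rewrite conjgE invgM !mulgA mulgK.
exact: normal_subgroupM (Nn.2 _ _ ga) hb.
Qed.

Lemma hpart_lcosM g h x y : hpart (lcos N g) x -> hpart (lcos N h) y ->
  hpart (lcos N (g * h)%g) (x * y).
Proof. by apply: (hpartM HgM) => c d; apply: lcosM. Qed.

End NormalSubgroup.

(** * From quasi-Hopf ideals to admissible pairs *)

Section IdealToPair.
Variables (I : set H) (QI : quasiHopf_ideal Q setT I).

Local Notation N := (ideal_subgroup Q Hg I).
Local Notation J := (pi @` I).

Let Is : subspace I. Proof. exact: qh_ideal_subspace QI. Qed.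

Let Js : subspace J. Proof. exact: subspace_image grading_map_linear Is. Qed.

Let idealMl x y : I y -> I (x * y).
Proof. by apply: (qh_ideal_mull QI). Qed.

Let idealMr x y : I x -> I (x * y).
Proof. by move=> Ix; apply: (qh_ideal_mulr QI). Qed.

(** Apply $\mathrm{id}\otimes f\pi$ to $\Delta(x)\in I\otimes H+H\otimes I$: the first summand goes
    into $I$, and the second is killed since $f$ vanishes on $\pi(I)$. *)
Lemma ideal_mult_functional (f : {malg K[G]} -> K) x : linear (f : _ -> K^o) ->
  (forall y, J y -> f y = 0) -> I x -> I (mult (fun g => f << g >>) x).
Proof.
move=> fl fJ /(qh_ideal_Delta QI); rewrite mult_functional //.
have fpl : linear (fun b => f (pi b) : K^o).
  by move=> a u v; rewrite grading_map_linear fl.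
have fpb : bilin (fun a b : H => f (pi b) *: a) by exact: bilin_scale _ fpl.
move: (Delta Q x); apply: sub_add_set.
- exact: subspace_preimage (tsum_linear fpb) Is.
- move=> t; apply: (tsum_tens_set fpb Is) => a b Ia _; exact: subspaceZ.
- move=> t; apply: (tsum_tens_set fpb Is) => a b _ Ib.
  by rewrite fJ; [rewrite scale0r; case/subspaceP: Is | exists b].
Qed.

(** If $x\in I$ maps to $\zeta_g-\zeta_h$, and $u,v$ have degrees $a,b$ and counit 1, then $uxv\in
    I$ maps to the translate, $\varepsilon$ being multiplicative. *)
Lemma ideal_diff_translate a b g h :
  J (<< g >> - << h >>) -> J (<< a * g * b >>%g - << a * h * b >>%g).
Proof.
case=> x Ix xgh; have [u au u1] := exists_eps1 a; have [v bv v1] := exists_eps1 b.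
exists (u * x * v); first by apply: idealMr; apply: idealMl.
apply/malgP => c; rewrite mcoeff_grading_map (components_mulr HgM _ _ bv).
rewrite (components_mull HgM _ _ au) !rmorphM /= u1 v1 mul1r mulr1.
rewrite -mcoeff_grading_map xgh !mcoeffB !mcoeffU.
have eqT d : (d == a^-1 * (c * b^-1))%g = (a * d * b == c)%g.
  by rewrite -(inj_eq (mulgI a)) mulVKg -(inj_eq (mulIg b)) mulgVK.
by rewrite !eqT.
Qed.

(** Identifies the cosets of $N_I$ with the classes of the $\zeta_g$ modulo $\pi(I)$, which are what
    functionals can separate. *)
Lemma ideal_subgroup_cosetP g h : lcos N g h <-> J (<< h >> - << g >>).
Proof.
split=> [/(ideal_diff_translate g 1%g)|/(ideal_diff_translate g^-1%g 1%g)].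
  by rewrite mulVKg !mulg1.
by rewrite mulVg !mulg1.
Qed.

Lemma ideal_subgroup1 : N 1%g.
Proof. by rewrite /ideal_subgroup /= subrr; case/subspaceP: Js. Qed.

Lemma ideal_subgroup_normal : normal_subgroup N.
Proof.
split=> [|n g /(ideal_diff_translate g^-1%g g)].
  split=> [|x y]; rewrite !inE; first exact: ideal_subgroup1.
  (* Translating $\zeta_e-\zeta_y$ by $x$ and $y^{-1}$ gives $\zeta_{xy^{-1}}-\zeta_x$, to which
     $\zeta_x-\zeta_e$ is added. *)
  move=> Nx /(subspaceN Js); rewrite opprB => /(ideal_diff_translate x y^-1%g).
  rewrite mulg1 mulgK => xy.
  by have := subspaceD Js xy Nx; rewrite addrA subrK.
by rewrite mulg1 mulVg -mulgA -conjgE.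
Qed.

(* Lagrange interpolation: the functionals of K[G] vanishing on pi(I) are
   constant on the cosets of N and separate any two of them. *)
Lemma ideal_mult_coset g x : I x -> I (mult (delta (lcos N g)) x).
Proof.
move=> Ix; pose s : seq G := finsupp (components Hg x).
(* The interpolating function is built one point of the support at a time, and only points outside
   $gN$ require a new factor. *)
have [c [cI cg cs]] : exists c : G -> K, [/\ forall y, I y -> I (mult c y),
    forall h, lcos N g h -> c h = 1 & forall h, h \in s -> ~ lcos N g h -> c h = 0].
  elim: s => [|h s [c [cI cg cs]]].
    exists (fun=> 1); split=> // y Iy; rewrite mult_const; exact: subspaceZ.
  have [gh|gh] := pselect (lcos N g h).
    exists c; split=> // h'; rewrite inE => /predU1P[->//|]; exact: cs.
  have nJ : ~ J (<< h >> - << g >>) := fun Jhg => gh ((ideal_subgroup_cosetP g h).2 Jhg).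
  have [f [fl fJ fhg]] := subspace_separation Js nJ.
  have fB y z : f (y - z) = f y - f z.
    by rewrite addrC -scaleN1r fl addrC -[_ *: _]mulrC mulrN1.
  have fd : f << g >> - f << h >> != 0 by rewrite -opprB oppr_eq0 -fB.
  (* The Lagrange factor: 0 at [h], and 1 on all of $gN$ because [f] is constant there. *)
  pose d k := (f << g >> - f << h >>)^-1 * (f << k >> + - f << h >>).
  exists (fun k => d k * c k); split=> [y Iy|k gk|k].
  (* Products of multipliers act by composition and constants by scaling, so only the values of [f]
     call on [ideal_mult_functional]. *)
  - rewrite -mult_comp /d -(mult_comp (fun=> _)) mult_const multD mult_const.
    apply: subspaceZ => //; apply: subspaceD => //.
      by apply: ideal_mult_functional => //; apply: cI.
    by apply: subspaceZ => //; apply: cI.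
  - rewrite cg // mulr1 /d; have := fJ _ ((ideal_subgroup_cosetP g k).1 gk).
    rewrite fB => /eqP; rewrite subr_eq0 => /eqP ->; exact: mulVf.
  - rewrite inE => /predU1P[-> _|ks gk]; first by rewrite /d subrr mulr0 mul0r.
    by rewrite cs // mulr0.
rewrite -(eq_mult (c := c)); first exact: cI.
move=> h hs; have [gh|gh] := pselect (lcos N g h).
  by rewrite cg // delta_in.
by rewrite delta_notin // cs.
Qed.

Local Notation KN := (I `&` hpart N).

Let Nn := ideal_subgroup_normal.

Let Ks : subspace KN. Proof. exact: subspaceI Is (hpart_subspace N). Qed.

Let N1 := ideal_subgroup1.

Let KE : KN = I `&` hpart (lcos N 1%g). Proof. by rewrite lcos1. Qed.

Let hpart_mul_ideal g h k : (g * h)%g = k ->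
  forall x y, hpart (lcos N g) x -> hpart (lcos N h) y ->
  I x \/ I y -> (I `&` hpart (lcos N k)) (x * y).
Proof.
move=> <- x y gx hy Ixy; split; last exact: hpart_lcosM gx hy.
by case: Ixy => ?; [apply: idealMr | apply: idealMl].
Qed.

(** Write $1=\sum ab$ with $a\in H_{gN}$ and $b\in H_{g^{-1}}$. Then $y=\sum a(by)$, and $by\in
    I\cap H_N$ when $y\in I\cap H_{gN}$. *)
Lemma ideal_coset_partl g :
  mul_set (hpart (lcos N g)) KN = I `&` hpart (lcos N g).
Proof.
rewrite KE; apply/seteqP; split=> [|y [Iy gy]].
  apply: mul_set_min => [|x y gx Ky].
    exact: subspaceI Is (hpart_subspace _).
  by apply: (hpart_mul_ideal (mulg1 g)) => //; [exact: Ky.2 | right; exact: Ky.1].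
rewrite -[y]mul1r; apply: (mul_set_mulr (lspan_subspace _) _ (@mul_set_hpart1 _ g N1)).
move=> a b ga gb; rewrite -mulrA; apply: mul_setM => //.
apply: (hpart_mul_ideal (mulVg g)) => //; last by right.
by apply: hom_hpart gb; apply: lcos_refl.
Qed.

(** Mirror argument, with $1=\sum ab$ for $a\in H_{g^{-1}N}$, $b\in H_g$, and $y=\sum(ya)b$. *)
Lemma ideal_coset_partr g :
  mul_set KN (hpart (lcos N g)) = I `&` hpart (lcos N g).
Proof.
rewrite KE; apply/seteqP; split=> [|y [Iy gy]].
  apply: mul_set_min => [|y x Ky gx].
    exact: subspaceI Is (hpart_subspace _).
  by apply: (hpart_mul_ideal (mul1g g)) => //; [exact: Ky.2 | left; exact: Ky.1].
rewrite -[y]mulr1; apply: (mul_set_mull (lspan_subspace _) _ (@mul_set_hpart1 _ g^-1%g N1)).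
rewrite invgK => a b ga gb; rewrite mulrA; apply: mul_setM.
  by apply: (hpart_mul_ideal (mulgV g)) => //; left.
by apply: hom_hpart gb; apply: lcos_refl.
Qed.

Lemma ideal_part_quasiHopf_ideal : quasiHopf_ideal Q (hpart N) KN.
Proof.
split.
- by move=> x [].
- exact: Ks.
- move=> x y Nx [Iy Ny]; rewrite KE.
  apply: (hpart_mul_ideal (mulg1 1%g)); rewrite ?lcos1 //; by right.
- move=> x y [Ix Nx] Ny; rewrite KE.
  apply: (hpart_mul_ideal (mulg1 1%g)); rewrite ?lcos1 //; by left.
- move=> x [Ix Nx].
  (* Let $p$ be the projection onto $H_N$. Then $p\otimes p$ fixes $\Delta(x)$ for $x\in H_N$, and
     since $p(I)\subseteq I\cap H_N$ it sends both summands of $I\otimes H+H\otimes I$ to the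
     required places. *)
  have prl := mult_is_linear (delta N).
  have prb : bilin (fun a b => mult (delta N) a ⊗ mult (delta N) b).
    exact: (bilin_comp (@tens_bilin K H H) prl prl).
  have prI a : I a -> KN (mult (delta N) a).
    move=> Ia; split; last exact: hpart_mult.
    by rewrite -(lcos1 N); apply: ideal_mult_coset.
  have -> : Delta Q x = tsum (fun a b => mult (delta N) a ⊗ mult (delta N) b) (Delta Q x).
    rewrite -[LHS]tsum_id.
    apply: (eq_tsum_tens_set (@tens_bilin K H H) prb _ (Delta_hpart Nx)).
    by move=> a b Na Nb; rewrite !mult_hpart.
  have Ds : subspace (add_set (tens_set KN (hpart N)) (tens_set (hpart N) KN)).
    exact: add_set_subspace (lspan_subspace _) (lspan_subspace _).
  move: (qh_ideal_Delta QI Ix); move: (Delta Q x); apply: sub_add_set.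
  + exact: subspace_preimage (tsum_linear prb) Ds.
  + move=> t; apply: (tsum_tens_set prb Ds) => a b Ia _.
    apply: sub_add_setl; first exact: lspan_subspace.
    by apply: tens_set_tens; [apply: prI | apply: hpart_mult].
  + move=> t; apply: (tsum_tens_set prb Ds) => a b _ Ib.
    apply: sub_add_setr; first exact: lspan_subspace.
    by apply: tens_set_tens; [apply: hpart_mult | apply: prI].
- by move=> x [/(qh_ideal_eps QI)].
- move=> x [Ix Nx]; split; first exact: (qh_ideal_antipode QI).
  apply: hpartS (antipode_hpart Nx) => g /=.
  by move=> /(normal_subgroupV Nn); rewrite invgK.
Qed.

Lemma pair_of_ideal_admissible :
  admissible Q Hg (pair_of_ideal Q Hg I).1 (pair_of_ideal Q Hg I).2.
Proof.
split=> /=.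
- exact: Nn.
- exact: ideal_part_quasiHopf_ideal.
- by move=> g; rewrite coset_partE; rewrite [LHS]ideal_coset_partl [RHS]ideal_coset_partr.
apply: lspan_min; first exact: subspace_image grading_map_linear Ks.
move=> _ [n Nn' <-]; have [x Ix xn] := Nn'.
(* The given preimage of $\zeta_n-\zeta_e$ may lie outside $H_N$; its projection has the same image,
   as both $n$ and $e$ are in $N$. *)
exists (mult (delta N) x).
  by split; [rewrite -(lcos1 N); apply: ideal_mult_coset | apply: hpart_mult].
apply/malgP => c; rewrite mcoeff_grading_map components_mult.
rewrite (linearZ_LR (eps Q)) /= -mcoeff_grading_map xn.
have [Nc|Nc] := pselect (N c); first by rewrite delta_in // mul1r.
rewrite delta_notin // mul0r mcoeffB !mcoeffU.
have nc h : N h -> (h == c) = false by move=> Nh; apply/eqP => hc; apply: Nc; rewrite -hc.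
by rewrite !nc ?subr0.
Qed.

(** The summand at [g] is $I\cap H_{gN}$, and these exhaust $I$ because it is stable under the coset
    projections. *)
Lemma pair_of_idealK : ideal_of_pair Hg (pair_of_ideal Q Hg I) = I.
Proof.
have cosetE g : mul_set (coset_part Hg N g) KN = I `&` hpart (lcos N g).
  by rewrite coset_partE ideal_coset_partl.
rewrite /ideal_of_pair /=; apply/seteqP; split.
  apply: lspan_min => // x [g _]; rewrite [X in X x -> _]cosetE; exact: proj1.
move=> x Ix.
have Frefl g : lcos N g g by apply: lcos_refl.
have := sub_lspan_hpart Is Frefl ideal_mult_coset Ix.
apply: lspan_min; first exact: lspan_subspace.
move=> y [g _ gy]; apply: sub_lspan; exists g => //.
by rewrite [X in X y]cosetE.
Qed.

End IdealToPair.

(** Meant for $\Delta(xy)=\Delta(x)\Delta(y)$ with $y\in J$ and $HJ\subseteq I$; everything reduces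
    to pure tensors. *)
Lemma add_tens_set_mull (I J : set H) s t :
  (forall x y, J y -> I (x * y)) ->
  add_set (tens_set J setT) (tens_set setT J) t ->
  add_set (tens_set I setT) (tens_set setT I) (s * t).
Proof.
move=> JI; pose D := add_set (tens_set I setT) (tens_set setT I).
have Ds : subspace D by apply: add_set_subspace; apply: lspan_subspace.
move: t; apply: (sub_add_set (subspace_preimage (mull_linear s) Ds)).
all: apply: (lspan_min (subspace_preimage (mull_linear s) Ds)).
all: move=> _ [x Jx [y Jy <-]] /=.
all: elim/tens_ind: s => [|u v s IH]; first by rewrite mul0r; case/subspaceP: Ds.
all: rewrite mulrDl tensM; apply: (subspaceD Ds) => //.
  apply: sub_add_setl; first exact: lspan_subspace.
  by apply: tens_set_tens => //; apply: JI.
apply: sub_add_setr; first exact: lspan_subspace.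
by apply: tens_set_tens => //; apply: JI.
Qed.

(** * From admissible pairs to quasi-Hopf ideals *)

Section PairToIdeal.
Variables (N : set G) (J : set H) (NJ : admissible Q Hg N J).

Local Notation L := (ideal_of_pair Hg (N, J)).

Let Nn := admissible_normal NJ.
Let QJ := admissible_ideal NJ.
Let Js : subspace J. Proof. exact: qh_ideal_subspace QJ. Qed.
Let Ls : subspace L. Proof. exact: lspan_subspace. Qed.
Let N1 := normal_subgroup1 Nn.

(** Coset parts are spanned by homogeneous elements, so closure properties of $K^{G/N}$ can be
    tested on products of a homogeneous element with an element of [J]. *)
Lemma ideal_of_pair_min (W : set H) : subspace W ->
  (forall h x y, Hg h x -> J y -> W (x * y)) -> L `<=` W.
Proof.
move=> Ws h; apply: lspan_min => // z [g _]; move: z.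
apply: mul_set_min => // x y + Jy; rewrite [coset_part _ _ _]coset_partE; move: x.
apply: hpart_min; first exact: subspace_preimage (mulr_linear y) Ws.
by move=> c x _ cx; apply: h cx Jy.
Qed.

Lemma ideal_of_pairM x y : J y -> L (x * y).
Proof.
move=> Jy; elim/hom_ind: x => [x x' Lx Lx'|g x gx].
  by rewrite mulrDl; apply: subspaceD Ls Lx Lx'.
apply: sub_lspan; exists g => //; apply: mul_setM => //.
by rewrite [coset_part _ _ _]coset_partE; apply: hom_hpart gx; apply: lcos_refl.
Qed.

Lemma ideal_of_pair_mull x y : L y -> L (x * y).
Proof.
move: y; apply: ideal_of_pair_min => [|h y z _ Jz].
  exact: subspace_preimage (mull_linear x) Ls.
by rewrite /= mulrA; apply: ideal_of_pairM.
Qed.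

Lemma ideal_of_pair_mulr x y : L x -> L (x * y).
Proof.
move: x; apply: ideal_of_pair_min => [|h x z _ Jz].
  exact: subspace_preimage (mulr_linear y) Ls.
rewrite /= -mulrA; apply: ideal_of_pair_mull.
elim/hom_ind: y => [y y' Ly Ly'|g y gy].
  by rewrite mulrDr; apply: subspaceD Ls Ly Ly'.
apply: sub_lspan; exists g => //.
(* Invariance replaces $H_{gN}J$ by $JH_{gN}$, where the product visibly lies. *)
rewrite [mul_set _ _](admissible_invariant NJ); apply: mul_setM => //.
by rewrite [coset_part _ _ _]coset_partE; apply: hom_hpart gy; apply: lcos_refl.
Qed.

Lemma sub_ideal_of_pair : J `<=` L.
Proof. by move=> x Jx; rewrite -[x]mul1r; apply: ideal_of_pairM. Qed.

Lemma ideal_of_pair_quasiHopf_ideal : quasiHopf_ideal Q setT L.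
Proof.
split.
- by [].
- exact: Ls.
- by move=> x y _; apply: ideal_of_pair_mull.
- by move=> x y Lx _; apply: ideal_of_pair_mulr.
- have Ds : subspace (add_set (tens_set L setT) (tens_set setT L)).
    by apply: add_set_subspace; apply: lspan_subspace.
  apply: ideal_of_pair_min => [|h x y _ Jy].
    exact: subspace_preimage (linearP (Delta Q)) Ds.
  rewrite /= rmorphM; apply: (add_tens_set_mull _ ideal_of_pairM).
  have := qh_ideal_Delta QJ Jy.
  apply: sub_add_set.
  + by apply: add_set_subspace; apply: lspan_subspace.
  + move=> t Jt; apply: sub_add_setl; first exact: lspan_subspace.
    by apply: tens_setS Jt.
  + move=> t Jt; apply: sub_add_setr; first exact: lspan_subspace.
    by apply: tens_setS Jt.
- apply: ideal_of_pair_min => [|h x y _ Jy].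
    exact: (subspace_preimage eps_linear (subspace_set1 _)).
  by rewrite /= rmorphM /= (qh_ideal_eps QJ Jy) mulr0.
- apply: ideal_of_pair_min => [|h x y _ Jy].
    exact: subspace_preimage (linearP (antipode Q)) Ls.
  (* The antipode reverses products, so the factor from [J] comes first and the right ideal property
     applies. *)
  rewrite /= antipodeM; apply: ideal_of_pair_mulr; apply: sub_ideal_of_pair.
  exact: qh_ideal_antipode QJ _ Jy.
Qed.

(** A generator $xy$ with $x\in H_h$, $y\in J\subseteq H_N$ lies in $H_{hN}$. If $h\in N$ it is in
    [J] and is fixed by the projection; otherwise the projection kills it. *)
Lemma mult_ideal_of_pair x : L x -> J (mult (delta N) x).
Proof.
move: x; apply: ideal_of_pair_min => [|h x y hx Jy].
  exact: subspace_preimage (mult_is_linear _) Js.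
have Ny : hpart N y := qh_ideal_sub QJ Jy.
have [Nh|Nh] /= := pselect (N h).
  have Jxy : J (x * y) by apply: (qh_ideal_mull QJ) => //; apply: hom_hpart hx.
  by rewrite mult_hpart //; apply: (qh_ideal_sub QJ).
rewrite (@mult_hpart0 (lcos N h)); first by case/subspaceP: Js.
  move=> c hc Nc; apply: Nh.
  rewrite -[h]invgK; apply: (normal_subgroupV Nn).
  by rewrite -[h^-1%g](mulgK c); apply: (normal_subgroupM Nn) => //; apply: normal_subgroupV.
rewrite -[h]mulg1; apply: (hpart_lcosM Nn); last by rewrite lcos1.
by apply: hom_hpart hx; apply: lcos_refl.
Qed.

(** If $\pi(x)=\zeta_g-\zeta_e$ with $g\notin N$, the projection of $x$ onto $H_N$ lies in [J] yet
    has counit $-1$, a contradiction. The converse inclusion is the augmentation condition. *)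
Lemma ideal_of_pair_subgroup : ideal_subgroup Q Hg L = N.
Proof.
apply/seteqP; split=> [g [x Lx xg]|n Nn']; last first.
  have [|x Jx xn] := admissible_augmentation NJ (t := << n >> - << 1%g >>).
    by apply: sub_lspan; exists n.
  by exists x => //; apply: sub_ideal_of_pair.
apply: contrapT => Ng.
have /eqP := qh_ideal_eps QJ (mult_ideal_of_pair Lx); apply/negP.
have g1 : (g == 1%g) = false by apply/eqP => g1; apply: Ng; rewrite g1.
have xE h : eps Q (components Hg x h) = (g == h)%:R - (1%g == h)%:R.
  by rewrite -mcoeff_grading_map xg mcoeffB !mcoeffU.
have x1 : 1%g \in finsupp (components Hg x).
  rewrite mem_finsupp; apply/eqP => x1; have /eqP := xE 1%g.
  by rewrite x1 (linear0 (eps Q)) g1 eqxx sub0r eq_sym oppr_eq0 oner_eq0.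
have -> : eps Q (mult (delta N) x) = -1.
  have -> : eps Q (mult (delta N) x) = \sum_(h <- finsupp (components Hg x))
      delta N h * ((g == h)%:R - (1%g == h)%:R).
    rewrite raddf_sum; apply: eq_bigr => h _.
    by rewrite /= (linearZ_LR (eps Q)) /= xE.
  (* Only degree $e$ contributes: the coefficient at $g$ is suppressed by [delta N]. *)
  rewrite (bigD1_seq 1%g) ?fset_uniq //= big1 => [|h h1].
    by rewrite delta_in // g1 eqxx mul1r sub0r addr0.
  rewrite [1%g == h]eq_sym (negPf h1) subr0.
  by case: eqP => [<-|]; rewrite ?mulr0 // delta_notin // mul0r.
by rewrite oppr_eq0 oner_eq0.
Qed.

Lemma ideal_of_pairK : pair_of_ideal Q Hg L = (N, J).
Proof.
rewrite /pair_of_ideal ideal_of_pair_subgroup; congr pair.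
apply/seteqP; split=> [x [Lx Nx]|x Jx].
  by rewrite -(mult_hpart Nx); apply: mult_ideal_of_pair.
by split; [apply: sub_ideal_of_pair | apply: (qh_ideal_sub QJ)].
Qed.

End PairToIdeal.
End GradedQuasiHopf.
End Graded.

Theorem theorem4p8 (k : fieldType) (G : groupType) (H : algType k)
    (Q : quasiHopf H) (Hg : G -> set H)
    (Hgraded : graded Q Hg) (Hfaithful : faithfully_graded Hg) :
  [/\ set_fun [set I | quasiHopf_ideal Q [set: H] I]
              [set p | admissible Q Hg p.1 p.2] (pair_of_ideal Q Hg),
      set_fun [set p | admissible Q Hg p.1 p.2]
              [set I | quasiHopf_ideal Q [set: H] I] (ideal_of_pair Hg),
      {in [set I | quasiHopf_ideal Q [set: H] I],
        cancel (pair_of_ideal Q Hg) (ideal_of_pair Hg)},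
      {in [set p | admissible Q Hg p.1 p.2],
        cancel (ideal_of_pair Hg) (pair_of_ideal Q Hg)} &
      set_bij [set I | quasiHopf_ideal Q [set: H] I]
              [set p | admissible Q Hg p.1 p.2] (pair_of_ideal Q Hg)].
Proof.
have Hdir := graded_direct Hgraded.
have pairP (I : set H) : quasiHopf_ideal Q setT I ->
    admissible Q Hg (pair_of_ideal Q Hg I).1 (pair_of_ideal Q Hg I).2.
  exact: pair_of_ideal_admissible.
have pairK (I : set H) : quasiHopf_ideal Q setT I ->
    ideal_of_pair Hg (pair_of_ideal Q Hg I) = I.
  exact: pair_of_idealK.
have idealP (p : set G * set H) : admissible Q Hg p.1 p.2 ->
    quasiHopf_ideal Q setT (ideal_of_pair Hg p).
  by case: p => N J; apply: ideal_of_pair_quasiHopf_ideal.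
have idealK (p : set G * set H) : admissible Q Hg p.1 p.2 ->
    pair_of_ideal Q Hg (ideal_of_pair Hg p) = p.
  by case: p => N J; apply: ideal_of_pairK.
split.
- exact: pairP.
- exact: idealP.
- by move=> I; rewrite inE => /pairK.
- by move=> p; rewrite inE => /idealK.
split=> [|I I'|p Ap]; first exact: pairP.
  by rewrite !inE => /pairK IK /pairK I'K II'; rewrite -IK II'.
by exists (ideal_of_pair Hg p); [apply: idealP | apply: idealK].
Qed.
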